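(* Let $k$ be a field with ${\rm char}(k)\neq 2$, let $n\geq 1$ be an integer, let $B\subset {\rm SL}_2(k)$ be the subgroup of upper triangular matrices, and let $g=\mathfrak h(\alpha)\,\mathfrak X_{12}(\psi)\in B$ with $\alpha\in k^*$, $\psi\in k$. Then: (1) If $\alpha=\pm1$, the equation $x^n=g$ has a solution $x\in B$ if and only if the equations $X^n=\alpha$ and $S_n(\alpha,X)\,Y-\psi X^{2(n-1)}=0$ have a simultaneous solution $X,Y\in k$. (2) If $\alpha\neq\pm1$, the equation $x^n=g$ has a solution $x\in B$ if and only if the equation $X^n=\alpha$ has a solution $X\in k$.
   Context: For $t\in k$ and $a\in k^*$ set $\mathfrak h(a)=\begin{pmatrix}a&0\\0&a^{-1}\end{pmatrix}$ and $\mathfrak X_{12}(t)=\begin{pmatrix}1&t\\0&1\end{pmatrix}$. For $\alpha\in k$ define the polynomials $S_{2m}(\alpha,X)=(1+\alpha)(1+X^2+X^4+\cdots+X^{2(m-1)})$ and $S_{2m+1}(\alpha,X)=1+\alpha X+X^2+\alpha X^3+X^4+\cdots+\alpha X^{2m-1}+X^{2m}$ (coefficient $1$ on even powers $X^0,X^2,\dots,X^{2m}$ and coefficient $\alpha$ on odd powers $X^1,X^3,\dots,X^{2m-1}$). *)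

(* Defs.v *)
From mathcomp Require Import all_boot all_order all_algebra.

Set Implicit Arguments.
Unset Strict Implicit.
Unset Printing Implicit Defensive.

Import GRing.Theory.
Local Open Scope ring_scope.

Definition mx2 (k : fieldType) (a b c d : k) : 'M[k]_2 :=
  \matrix_(i < 2, j < 2)
    if i == 0 then (if j == 0 then a else b) else (if j == 0 then c else d).

Definition hdiag (k : fieldType) (a : k) : 'M[k]_2 := mx2 a 0 0 a^-1.

Definition X12 (k : fieldType) (t : k) : 'M[k]_2 := mx2 1 t 0 1.

Definition SL2 (k : fieldType) : {pred 'M[k]_2} := [pred A | \det A == 1].
Arguments SL2 k : clear implicits.

(* [is_trig_mx] means lower triangular, hence the transpose. *)
Definition borel (k : fieldType) : {pred 'M[k]_2} :=
  [pred A | (A \in SL2 k) && is_trig_mx A^T].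
Arguments borel k : clear implicits.

Definition Spoly (k : fieldType) (n : nat) (alpha : k) : {poly k} :=
  let m := n./2 in
  if odd n then
    \sum_(i < m.+1) 'X^(2 * i) + \sum_(i < m) alpha *: 'X^(2 * i + 1)
  else (1 + alpha) *: \sum_(i < m) 'X^(2 * i).

Lemma hdiag_X12_borel (k : fieldType) (alpha psi : k) :
  alpha != 0 -> hdiag alpha *m X12 psi \in borel k.
Proof.
have det2 (a b c d : k) : \det (mx2 a b c d) = a * d - b * c.
  rewrite (expand_det_row _ 0) !big_ord_recl big_ord0 addr0 /cofactor !det_mx11.
  by rewrite !mxE /= expr0 expr1 mul1r mulN1r mulrN.
move=> a0; rewrite !inE det_mulmx !det2 !mul0r !mulr0 !subr0.
rewrite divff // !mulr1 eqxx /=; apply/is_trig_mxP => i j lt_ij.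
have [-> ->] : i = 0 /\ j = 1.
  by split; apply: val_inj; case: i j lt_ij => [[|[|//]] ?] [[|[|//]] ?].
by rewrite !mxE !big_ord_recl big_ord0 !mxE /= mul0r mulr0 !addr0.
Qed.

(* Main.v *)
Require Import Defs.
From mathcomp Require Import all_boot all_order all_algebra.
From mathcomp Require Import ring.

(** Every element of [B] is [h(a) X12(t)], and
    [(h(a) X12(t))^n = h(a^n) X12(t * \sum_(i < n) a^(-2i))].
    Multiplying by [a^(2(n-1))] turns the last sum into [\sum_(i < n) a^(2i)],
    which is [S_n(alpha, a)] as soon as [a^n = alpha]; hence, for every [alpha],
    the solutions in [B] correspond to the pairs [(X, Y) = (a, t)].  Moreover
    [(a^2 - 1) S_n(alpha, a) = alpha^2 - 1], so the equation for [Y] is always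
    solvable when [alpha] is not [1] or [-1]. *)

Set Implicit Arguments.
Unset Strict Implicit.
Unset Printing Implicit Defensive.

Import GRing.Theory.
Local Open Scope ring_scope.

Lemma hdiag_X12E (k : fieldType) (a t : k) :
  hdiag a *m X12 t = mx2 a (a * t) 0 a^-1.
Proof.
apply/matrixP => i j; rewrite !mxE !big_ord_recl big_ord0 !mxE /=.
by case: i j => [[|[|//]] ?] [[|[|//]] ?] /=; ring.
Qed.

Lemma mx2_inj (k : fieldType) (a b c d a' b' c' d' : k) :
  mx2 a b c d = mx2 a' b' c' d' -> [/\ a = a', b = b', c = c' & d = d'].
Proof.
move=> /matrixP E; have := (E 0 0, E 0 1, E 1 0, E 1 1).
by rewrite !mxE /= => -[[[-> ->] ->] ->].
Qed.

Lemma mulmx_mx2 (k : fieldType) (a b c d a' b' c' d' : k) :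
  mx2 a b c d *m mx2 a' b' c' d' =
  mx2 (a * a' + b * c') (a * b' + b * d') (c * a' + d * c') (c * b' + d * d').
Proof.
apply/matrixP => i j; rewrite !mxE !big_ord_recl big_ord0 !mxE /= addr0.
by case: i j => [[|[|//]] ?] [[|[|//]] ?].
Qed.

Lemma hdiag_X12_inj (k : fieldType) (a b s t : k) : a != 0 ->
  hdiag a *m X12 s = hdiag b *m X12 t -> a = b /\ s = t.
Proof.
by move=> a0; rewrite !hdiag_X12E => /mx2_inj[<- /(mulfI a0)].
Qed.

(** A triangular determinant is the product of the diagonal, so the diagonal entries are mutually
    inverse; dividing the corner entry by [A 0 0] gives [t]. *)
Lemma borel_hdiag_X12 (k : fieldType) (A : 'M[k]_2) : A \in borel k ->
  exists a t : k, a != 0 /\ A = hdiag a *m X12 t.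
Proof.
case/andP => /eqP detA /is_trig_mxP/(_ 0 1 isT); rewrite mxE => A10.
have A00A11 : A 0 0 * A 1 1 = 1.
  rewrite -detA -det_tr det_trig ?big_ord_recl ?big_ord0 ?mxE ?mulr1.
    by congr (_ * A _ _); apply: val_inj.
  apply/is_trig_mxP => i j; rewrite mxE.
  case: i j => [[|[|//]] ?] [[|[|//]] ?] //= _.
  by rewrite -[RHS]A10; congr (A _ _); apply: val_inj.
have A00 : A 0 0 != 0.
  by apply/eqP => A0; move/eqP: A00A11; rewrite A0 mul0r eq_sym oner_eq0.
exists (A 0 0), (A 0 1 / A 0 0); split=> //.
(* The inverse of [A 0 0] becomes [A 1 1] by expanding the factor [1] as [A 0 0 * A 1 1]. *)
rewrite hdiag_X12E mulrC divfK // -[_^-1]mulr1 -A00A11 mulKf //.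
apply/matrixP => i j; rewrite mxE.
case: i j => [[|[|//]] ?] [[|[|//]] ?] /=; rewrite -?[RHS]A10;
  by congr (A _ _); apply: val_inj.
Qed.

(** Since [X12 t *m hdiag b = hdiag b *m X12 (t * b ^- 2)], moving a new left factor's unipotent
    part past [hdiag (a ^+ n)] contributes the term [t * a ^- (2 * n)]. *)
Lemma hdiag_X12_exp (k : fieldType) (a t : k) (n : nat) : a != 0 ->
  (hdiag a *m X12 t) ^+ n =
  hdiag (a ^+ n) *m X12 (t * \sum_(i < n) a ^- (2 * i)).
Proof.
move=> a0; elim: n => [|n IHn].
  rewrite big_ord0 !expr0 hdiag_X12E !mulr0 invr1.
  by apply/matrixP => i j; rewrite !mxE; case: i j => [[|[|//]] ?] [[|[|//]] ?].
rewrite exprS IHn -[LHS]/(_ *m _) !hdiag_X12E mulmx_mx2 big_ord_recr /=.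
have an0 : a ^+ n != 0 by rewrite expf_neq0.
by rewrite exprS mulnC exprM; congr mx2; field; rewrite ?a0 ?an0.
Qed.

(** The substitution of [n - 1 - i] for [i] matches the terms; for [n = 0], where [n - 1] truncates,
    both sums are empty. *)
Lemma sum_exprV_rev (k : fieldType) (a : k) (n : nat) : a != 0 ->
  (\sum_(i < n) a ^- (2 * i)) * a ^+ (2 * (n - 1)) = \sum_(i < n) a ^+ (2 * i).
Proof.
move=> a0; rewrite mulr_suml [RHS](reindex_inj rev_ord_inj) /=.
apply: eq_bigr => i _; have lt_in := ltn_ord i.
have -> : (2 * (n - 1) = 2 * (n - i.+1) + 2 * i)%N.
  by rewrite -mulnDr -{1}(subnK lt_in) addnS subn1.
by rewrite exprD mulrC mulfK // expf_neq0.
Qed.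

(** Among the powers [x ^+ (2 * i)], those of exponent at least [n] contain a factor
    [x ^+ n = alpha]. What remains has even exponent if [n] is even and odd exponent if [n] is odd,
    whence the two shapes of [Spoly]. *)
Lemma horner_Spoly (k : fieldType) (n : nat) (alpha x : k) : x ^+ n = alpha ->
  (Spoly n alpha).[x] = \sum_(i < n) x ^+ (2 * i).
Proof.
move=> <-; rewrite /Spoly; set m := n./2.
have def_n : n = (odd n + (m + m))%N by rewrite addnn odd_double_half.
have horner_sum_even p : (\sum_(i < p) 'X^(2 * i)).[x] = \sum_(i < p) x ^+ (2 * i).
  by rewrite horner_sum; apply: eq_bigr => i _; rewrite hornerXn.
case: (odd n) def_n => def_n; rewrite def_n; last first.
  rewrite add0n hornerZ horner_sum_even big_split_ord /= mulrDl mul1r.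
  congr (_ + _); rewrite mulr_sumr; apply: eq_bigr => i _.
  by rewrite -exprD mulnDr [(2 * m)%N]mul2n addnn.
rewrite add1n -addSn hornerD horner_sum_even big_split_ord /=.
congr (_ + _); rewrite horner_sum; apply: eq_bigr => i _.
rewrite hornerZ hornerXn -exprD; congr (x ^+ _).
by rewrite mulnDr !mul2n -!addnn addn1 !addSn !addnS !addnA.
Qed.

Lemma borel_root_iff (k : fieldType) (n : nat) (alpha psi : k) :
  (0 < n)%N -> alpha != 0 ->
  (exists x : 'M[k]_2, x \in borel k /\ x ^+ n = hdiag alpha *m X12 psi) <->
  (exists X Y : k, X ^+ n = alpha /\
     (Spoly n alpha).[X] * Y - psi * X ^+ (2 * (n - 1)) = 0).
Proof.
move=> n0 alpha0; split=> [[x [/borel_hdiag_X12[a [t [a0 ->]]]]]|].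
  rewrite hdiag_X12_exp // => /hdiag_X12_inj[|an <-]; first exact: expf_neq0.
  exists a, t; split=> //.
  by rewrite (horner_Spoly an) -mulrA sum_exprV_rev // mulrC subrr.
move=> [a [t [an /eqP]]]; rewrite subr_eq0 => /eqP eqt.
have a0 : a != 0.
  by apply: contra_neq alpha0 => a0; rewrite -an a0 expr0n gtn_eqF.
exists (hdiag a *m X12 t); split; first exact: hdiag_X12_borel.
rewrite hdiag_X12_exp // an; congr (_ *m X12 _).
apply: (mulIf (expf_neq0 (2 * (n - 1)) a0)).
by rewrite -eqt (horner_Spoly an) -mulrA sum_exprV_rev // mulrC.
Qed.

Lemma horner_Spoly_neq0 (k : fieldType) (n : nat) (alpha x : k) :
  x ^+ n = alpha -> alpha ^+ 2 != 1 -> (Spoly n alpha).[x] != 0.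
Proof.
(* Writing [alpha ^+ 2] as [(x ^+ 2) ^+ n] exposes a geometric sum of ratio [x ^+ 2]. *)
move=> xn; apply: contra_neq => S0; apply/eqP; rewrite -subr_eq0 -{1}xn exprAC.
rewrite subrX1 (eq_bigr (fun i : 'I_n => x ^+ (2 * i))) => [|i _].
  by rewrite -(horner_Spoly xn) S0 mulr0.
by rewrite exprM.
Qed.

Theorem proposition4p1 (k : fieldType) (n : nat) (alpha psi : k)
    (char_k : 2%N \notin [pchar k]) (n_ge1 : (1 <= n)%N)
    (alpha_neq0 : alpha != 0) :
  let g : 'M[k]_2 := hdiag alpha *m X12 psi in
  (alpha = 1 \/ alpha = -1 ->
     ((exists x : 'M[k]_2, x \in borel k /\ x ^+ n = g) <->
      (exists X Y : k, X ^+ n = alpha /\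
         (Spoly n alpha).[X] * Y - psi * X ^+ (2 * (n - 1)) = 0)))
  /\
  (~ (alpha = 1 \/ alpha = -1) ->
     ((exists x : 'M[k]_2, x \in borel k /\ x ^+ n = g) <->
      (exists X : k, X ^+ n = alpha))).
Proof.
move=> g; have root_iff := borel_root_iff psi n_ge1 alpha_neq0.
split=> // alpha_n1; split=> [/root_iff[X [Y [Xn _]]]|[X Xn]]; first by exists X.
have S0 : (Spoly n alpha).[X] != 0.
  apply: horner_Spoly_neq0 => //; rewrite sqrf_eq1.
  by apply/negP => /orP[] /eqP alpha1; apply: alpha_n1; [left|right].
(* The equation is linear in [Y] with nonzero leading coefficient, so it is solved by division. *)
apply/root_iff; exists X, (psi * X ^+ (2 * (n - 1)) / (Spoly n alpha).[X]).
by rewrite mulrC divfK // subrr.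
Qed.
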